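(* For each of the two metamaterials (Kagome and Rotating Squares) there exist a threshold $\eta_0>0$ and a constant $C>0$, with $C$ independent of $\lambda$ and $\eta$, such that for every $\eta$ with $0<\eta<\eta_0$ and every matrix $\lambda\in\mathbb{R}^{2\times 2}$ the effective energy density satisfies $$\overline{W}^\eta(\lambda)\ \geq\ C\Big[(\lambda_1-\lambda_2)^2+(\lambda_1-1)_+^2+(\lambda_2-1)_+^2\Big]\quad\text{if }\det(\lambda)\geq 0,$$ $$\overline{W}^\eta(\lambda)\ \geq\ C\Big[(\lambda_1+\lambda_2)^2+(\lambda_1-1)_+^2+(\lambda_2-1)_+^2\Big]\quad\text{if }\det(\lambda)<0,$$ where $\lambda_1,\lambda_2$ are the principal stretches of $\lambda$, i.e. the eigenvalues of $(\lambda^T\lambda)^{1/2}$, and $(x-1)_+^2=(\max\{x-1,0\})^2$.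
   Context: Kagome metamaterial. Lattice vectors $v_1=(2,0)^T$, $v_2=(1,\sqrt3)^T$. Points $O=(0,0)$, $A=(\tfrac12,\tfrac{\sqrt3}{2})$, $B=(-\tfrac12,\tfrac{\sqrt3}{2})$, $C=(-\tfrac12,-\tfrac{\sqrt3}{2})$, $D=(\tfrac12,-\tfrac{\sqrt3}{2})$, $E=(\tfrac32,-\tfrac{\sqrt3}{2})$, $F=(\tfrac32,\tfrac{\sqrt3}{2})$. The unit cell $U$ is the rectangle with vertices $B,C,E,F$; the basic set of nodes is $V=\{A,O,D\}$. The spring energy is $$E_{\rm spr}(u,U)=\sum_{(P,Q)}\big(|u(P)-u(Q)|-|P-Q|\big)^2,$$ the sum being over the six springs $AO,BO,CO,DO,AF,DE$. The penalized triangles are $\Delta AOB$ and $\Delta COD$. Rotating Squares metamaterial. Lattice vectors $v_1=(2,0)^T$, $v_2=(0,2)^T$. Points $A=(-1,1)$, $B=(0,1)$, $C=(1,1)$, $D=(-1,0)$, $O=(0,0)$, $E=(1,0)$, $F=(-1,-1)$, $G=(0,-1)$, $H=(1,-1)$. The unit cell $U$ is the square with vertices $A,C,H,F$; the basic set of nodes is $V=\{O,A,B,D\}$. The spring energy is $$E_{\rm spr}(u,U)=\sum_{(P,Q)}c_{PQ}\big(|u(P)-u(Q)|-|P-Q|\big)^2,$$ the sum being over the ten springs $AB,AO,AD,BC,BO,DO,EO,DF,OG,OH$, with $c_{PQ}=2$ for the diagonal springs $AO,OH$ and $c_{PQ}=1$ for the other eight. The penalized triangles are $\Delta AOB,\Delta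 AOD,\Delta EOH,\Delta GOH$. For both: the set of nodes is $\mathcal V=\bigcup_{\alpha_1,\alpha_2\in\mathbb Z}(V+\alpha_1v_1+\alpha_2v_2)$. A deformation is a function $u:\mathcal V\to\mathbb R^2$. For a triangle $T$ with vertices in $\mathcal V$, $Du|_T$ is the (constant) gradient of the affine interpolant of $u$ on $T$, and $|T|$ is its area. For $\eta>0$ put $f^\eta(t)=1/\eta$ for $t\le 0$, $f^\eta(t)=0$ for $t>0$, and $$E^\eta(u,U)=E_{\rm spr}(u,U)+\sum_{T}|T|\,f^\eta(\det Du|_T),$$ the sum being over the penalized triangles. For $\alpha=\alpha_1v_1+\alpha_2v_2$ with $\alpha_1,\alpha_2\in\mathbb Z$, $E^\eta(u,U+\alpha):=E^\eta(u(\cdot+\alpha),U)$. Effective energy density. A deformation $\psi:\mathcal V\to\mathbb R^2$ is $k$-periodic ($k\in\mathbb N$, $k\ge1$) if $\psi(x+kv_1)=\psi(x+kv_2)=\psi(x)$ for all $x\in\mathcal V$; $\mathcal A^{\#}(kU)$ denotes the set of these. For $\lambda\in\mathbb R^{2\times2}$, $\lambda x+\psi$ denotes the deformation $x\mapsto\lambda x+\psi(x)$ on $\mathcal V$. Then $$\overline W^\eta(\lambda)=\inf_{k\in\mathbb N}\ \inf_{\psi\in\mathcal A^{\#}(kU)}\ \frac1{k^2|U|}\sum_{\alpha_1,\alpha_2=0}^{k-1}E^\eta(\lambda x+\psi,\,U+\alpha_1v_1+\alpha_2v_2).$$ *)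

(* Defs.v *)
From mathcomp Require Import all_boot all_order all_algebra.
From mathcomp Require Import classical_sets reals.
From mathcomp Require Import ring.

Set Implicit Arguments.
Unset Strict Implicit.
Unset Printing Implicit Defensive.

Import Order.TTheory GRing.Theory Num.Theory.

Local Open Scope classical_set_scope.
Local Open Scope ring_scope.

Definition pt (R : realType) (x y : R) : 'cV[R]_2 :=
  \col_(i < 2) (if i == 0 then x else y).

(* Euclidean norm; the norm that MathComp-Analysis puts on matrices is the
   sup norm. *)
Definition enorm (R : realType) (x : 'cV[R]_2) : R :=
  Num.sqrt (\sum_i x i 0 ^+ 2).

Definition triangle (R : realType) : Type :=
  ('cV[R]_2 * 'cV[R]_2 * 'cV[R]_2)%type.

(* The columns are the edge vectors Q - P and W - P. *)
Definition edge_mx (R : realType) (P Q W : 'cV[R]_2) : 'M[R]_2 :=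
  row_mx (Q - P) (W - P).

Definition triangle_area (R : realType) (T : triangle R) : R :=
  let: (P, Q, W) := T in `|\det (edge_mx P Q W)| / 2.

(* The linear part of the affine map that agrees with u at the three vertices
   of T; see [affine_gradientP]. *)
Definition affine_gradient (R : realType) (u : 'cV[R]_2 -> 'cV[R]_2)
    (T : triangle R) : 'M[R]_2 :=
  let: (P, Q, W) := T in edge_mx (u P) (u Q) (u W) *m invmx (edge_mx P Q W).

Lemma affine_gradientP (R : realType) (u : 'cV[R]_2 -> 'cV[R]_2)
    (P Q W : 'cV[R]_2) (G : 'M[R]_2) :
  \det (edge_mx P Q W) != 0 ->
  (exists b : 'cV[R]_2,
     [/\ G *m P + b = u P, G *m Q + b = u Q & G *m W + b = u W]) <->
  G = affine_gradient u (P, Q, W).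
Proof.
move=> nz; have uE : edge_mx P Q W \in unitmx by rewrite unitmxE unitfE.
split=> [[b [hP hQ hW]]|hG].
  rewrite /affine_gradient -[LHS](mulmxK uE); congr (_ *m _).
  rewrite {1}/edge_mx (mul_mx_row G (Q - P) (W - P)) !mulmxBr.
  have cancel (x y : 'cV[R]_2) : (x + b) - (y + b) = x - y.
    by rewrite opprD addrACA subrr addr0.
  by rewrite -hP -hQ -hW /edge_mx !cancel.
have : G *m edge_mx P Q W = edge_mx (u P) (u Q) (u W).
  by rewrite hG /affine_gradient mulmxKV.
rewrite {1}/edge_mx (mul_mx_row G (Q - P) (W - P)) /edge_mx.
move=> /(@eq_row_mx _ 2 1 1)[hQ hW]; exists (u P - G *m P).
split; first by rewrite addrC subrK.
  by rewrite addrCA -mulmxBr hQ addrC subrK.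
by rewrite addrCA -mulmxBr hW addrC subrK.
Qed.

(* The unit cell is a rectangle, given by a corner and its two neighbouring
   corners; its area is then |det| of the two edge vectors. A spring (c, P, Q)
   joins P to Q with coefficient c. *)
Record metamaterial (R : realType) := Metamaterial {
  lat1 : 'cV[R]_2;
  lat2 : 'cV[R]_2;
  cell_corners : 'cV[R]_2 * 'cV[R]_2 * 'cV[R]_2;
  basic_nodes : seq 'cV[R]_2;
  springs : seq (R * 'cV[R]_2 * 'cV[R]_2);
  penalized : seq (triangle R)
}.

Definition kagome (R : realType) : metamaterial R :=
  let s := Num.sqrt 3 : R in
  let O := pt 0 0 in
  let A := pt (1 / 2) (s / 2) in
  let B := pt (- (1 / 2)) (s / 2) in
  let C := pt (- (1 / 2)) (- (s / 2)) in
  let D := pt (1 / 2) (- (s / 2)) in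
  let E := pt (3 / 2) (- (s / 2)) in
  let F := pt (3 / 2) (s / 2) in
  {| lat1 := pt 2 0;
     lat2 := pt 1 s;
     cell_corners := (C, E, B);
     basic_nodes := [:: A; O; D];
     springs := [:: (1, A, O); (1, B, O); (1, C, O); (1, D, O);
                    (1, A, F); (1, D, E)];
     penalized := [:: (A, O, B); (C, O, D)] |}.

Definition rotating_squares (R : realType) : metamaterial R :=
  let A := pt (- 1) 1 : 'cV[R]_2 in
  let B := pt 0 1 in
  let C := pt 1 1 in
  let D := pt (- 1) 0 in
  let O := pt 0 0 in
  let E := pt 1 0 in
  let F := pt (- 1) (- 1) in
  let G := pt 0 (- 1) in
  let H := pt 1 (- 1) in
  {| lat1 := pt 2 0;
     lat2 := pt 0 2;
     cell_corners := (F, H, A);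
     basic_nodes := [:: O; A; B; D];
     springs := [:: (1, A, B); (2, A, O); (1, A, D); (1, B, C); (1, B, O);
                    (1, D, O); (1, E, O); (1, D, F); (1, O, G); (2, O, H)];
     penalized := [:: (A, O, B); (A, O, D); (E, O, H); (G, O, H)] |}.

Section Energy.
Variables (R : realType) (M : metamaterial R).
Implicit Types (u psi : 'cV[R]_2 -> 'cV[R]_2) (eta : R) (lam : 'M[R]_2).

Definition cell_area : R :=
  let: (P, Q, W) := cell_corners M in `|\det (edge_mx P Q W)|.

Definition nodes : set 'cV[R]_2 :=
  [set x | exists v (a1 a2 : int),
     v \in basic_nodes M /\ x = v + lat1 M *~ a1 + lat2 M *~ a2].

(* A deformation is encoded as a function on the whole plane of which only the
   values on [nodes] matter: see [cell_energy_nodes] below. *)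
Definition spring_energy u : R :=
  \sum_(s <- springs M)
    let: (c, P, Q) := s in c * (enorm (u P - u Q) - enorm (P - Q)) ^+ 2.

Definition penalty eta (t : R) : R := if t <= 0 then eta^-1 else 0.

Definition energy eta u : R :=
  spring_energy u +
  \sum_(T <- penalized M)
    triangle_area T * penalty eta (\det (affine_gradient u T)).

Definition cell_energy eta u (a1 a2 : nat) : R :=
  energy eta (fun x => u (x + (lat1 M *+ a1 + lat2 M *+ a2))).

Definition periodic (k : nat) : set ('cV[R]_2 -> 'cV[R]_2) :=
  [set psi | forall x, nodes x ->
     psi (x + lat1 M *+ k) = psi x /\ psi (x + lat2 M *+ k) = psi x].

Definition mean_energy eta lam (k : nat) psi : R :=
  (\sum_(a1 < k) \sum_(a2 < k)
     cell_energy eta (fun x => lam *m x + psi x) a1 a2) /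
  (k%:R ^+ 2 * cell_area).

Definition effective_energy eta lam : R :=
  inf [set inf [set mean_energy eta lam k psi | psi in periodic k]
      | k in [set k | (0 < k)%N]].

End Energy.

(* l1 and l2 are the eigenvalues, with multiplicity, of the symmetric positive
   semidefinite square root U of lam^T *m lam. *)
Definition principal_stretches (R : realType) (lam : 'M[R]_2) (l1 l2 : R) :
    Prop :=
  exists U : 'M[R]_2,
    [/\ U^T = U, forall x : 'cV[R]_2, 0 <= (x^T *m U *m x) 0 0,
        U *m U = lam^T *m lam &
        char_poly U = ('X - l1%:P) * ('X - l2%:P)].

Definition pos_part (R : realType) (x : R) : R := Num.max x 0.

Lemma nodesD (R : realType) (M : metamaterial R) (x : 'cV[R]_2) (a1 a2 : nat) :
  nodes M x -> nodes M (x + (lat1 M *+ a1 + lat2 M *+ a2)).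
Proof.
move=> [v [b1 [b2 [vM ->]]]]; exists v, (b1 + a1%:Z), (b2 + a2%:Z); split=> //.
by rewrite !mulrzDr -!pmulrn addrACA (addrA v).
Qed.

Lemma pt_lattice (R : realType) (a b c d e f : R) (m n : int) :
  pt a b + pt c d *~ m + pt e f *~ n =
  pt (a + c * m%:~R + e * n%:~R) (b + d * m%:~R + f * n%:~R).
Proof.
apply/matrixP=> i j.
rewrite -!scaler_int !mxE; case: ifP => _; by rewrite !(mulrC _%:~R).
Qed.

Lemma pt_node (R : realType) (M : metamaterial R) (a b c d e f x y : R)
    (m n : int) :
  lat1 M = pt c d -> lat2 M = pt e f -> pt a b \in basic_nodes M ->
  x = a + c * m%:~R + e * n%:~R -> y = b + d * m%:~R + f * n%:~R ->
  nodes M (pt x y).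
Proof.
move=> h1 h2 hM -> ->; exists (pt a b), m, n; split=> //.
by rewrite h1 h2 pt_lattice.
Qed.

Local Ltac node a b m n :=
  eapply (@pt_node _ _ a b _ _ _ _ _ _ m n);
  [ reflexivity | reflexivity | by rewrite !inE eqxx ?orbT
  | by field | rewrite /=; try move: (Num.sqrt _) => ?; by field ].

Lemma kagome_nodes (R : realType) (s := Num.sqrt 3 : R) :
  [/\ nodes (kagome R) (pt 0 0), nodes (kagome R) (pt (1 / 2) (s / 2)),
      nodes (kagome R) (pt (- (1 / 2)) (s / 2)) &
      nodes (kagome R) (pt (- (1 / 2)) (- (s / 2)))] /\
  [/\ nodes (kagome R) (pt (1 / 2) (- (s / 2))),
      nodes (kagome R) (pt (3 / 2) (- (s / 2))) &
      nodes (kagome R) (pt (3 / 2) (s / 2))].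
Proof.
rewrite /s {s}; split; split.
- node (0 : R) (0 : R) (0 : int) (0 : int).
- node (1 / 2 : R) (Num.sqrt 3 / 2 : R) (0 : int) (0 : int).
- node (1 / 2 : R) (- (Num.sqrt 3 / 2 : R)) (-1 : int) (1 : int).
- node (1 / 2 : R) (Num.sqrt 3 / 2 : R) (0 : int) (-1 : int).
- node (1 / 2 : R) (- (Num.sqrt 3 / 2 : R)) (0 : int) (0 : int).
- node (1 / 2 : R) (Num.sqrt 3 / 2 : R) (1 : int) (-1 : int).
- node (1 / 2 : R) (- (Num.sqrt 3 / 2 : R)) (0 : int) (1 : int).
Qed.

Lemma rotating_squares_nodes (R : realType) (M := rotating_squares R) :
  [/\ nodes M (pt (- 1) 1), nodes M (pt 0 1), nodes M (pt 1 1),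
      nodes M (pt (- 1) 0) & nodes M (pt 0 0)] /\
  [/\ nodes M (pt 1 0), nodes M (pt (- 1) (- 1)), nodes M (pt 0 (- 1)) &
      nodes M (pt 1 (- 1))].
Proof.
split; split.
- node (- 1 : R) (1 : R) (0 : int) (0 : int).
- node (0 : R) (1 : R) (0 : int) (0 : int).
- node (- 1 : R) (1 : R) (1 : int) (0 : int).
- node (- 1 : R) (0 : R) (0 : int) (0 : int).
- node (0 : R) (0 : R) (0 : int) (0 : int).
- node (- 1 : R) (0 : R) (1 : int) (0 : int).
- node (- 1 : R) (1 : R) (0 : int) (-1 : int).
- node (0 : R) (1 : R) (0 : int) (-1 : int).
- node (- 1 : R) (1 : R) (1 : int) (-1 : int).
Qed.

Lemma cell_energy_nodes (R : realType) (M : metamaterial R) (eta : R)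
    (u v : 'cV[R]_2 -> 'cV[R]_2) (a1 a2 : nat) :
  M = kagome R \/ M = rotating_squares R ->
  (forall x, nodes M x -> u x = v x) ->
  cell_energy M eta u a1 a2 = cell_energy M eta v a1 a2.
Proof.
move=> hM huv; suff energy_nodes w z : (forall x, nodes M x -> w x = z x) ->
    energy M eta w = energy M eta z.
  by apply: energy_nodes => x hx; apply/huv/nodesD.
case: hM {huv} => -> hwz; rewrite /energy /spring_energy !big_cons !big_nil /=.
  by have [[? ? ? ?] [? ? ?]] := kagome_nodes R; rewrite !hwz.
by have [[? ? ? ? ?] [? ? ? ?]] := rotating_squares_nodes R; rewrite !hwz.
Qed.

(* Main.v *)
Require Import Defs.
From mathcomp Require Import all_boot all_order all_algebra.
From mathcomp Require Import classical_sets reals.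
From mathcomp Require Import ring lra.

(** Identify the plane with the complex numbers and write a 2 x 2 matrix [F] as
[z |-> p z + q conj(z)]. Then [\det F = |p|^2 - |q|^2], the principal stretches
of [F] are [|p| + |q|] and [||p| - |q||], and the map is a similarity or a
reflected similarity when [q = 0] or [p = 0]. In particular [2 |q|] is
[|l1 - l2|] when [0 <= \det F] and [l1 + l2] when [\det F < 0], so that both
inequalities of the theorem follow from one lower bound of the effective energy
by a multiple of

  [excess F = |q|^2 + ((|p| - 1)_+)^2]

([stretches_le_excess]). This function is convex, and no case distinction on
the sign of the determinant is left.

For a single rigid triangle the bound holds pointwise: the energy of the three
edges and the penalty control the excess of the affine gradient [F]
([excess_le_springs]). The squared stretch of an edge is [|p|^2 + |q|^2] plus
[2 |p| |q|] times the cosine of an angle that depends on the direction of the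
edge. The three cosines are not all equal, so if the three stretches are close
to [1] then [|p| |q|] is small, whence the smaller of [|p|] and [|q|] is small
and the larger one is close to [1]. If [|q|] is at least [|p|] then
[\det F <= 0], and the penalty, large because [eta < 1], pays for the
excess.

Both materials contain in each cell two rigid triangles [(A, O, B)] and
[(A', O, B')] that are images of each other under the point reflection at [O],
with [A], [A'] and [B], [B'] congruent modulo the lattice. For periodic [psi]
the values at congruent nodes have equal sums over a period, and the reflection
reverses the edges; hence the gradients of [psi] on the two kinds of triangles
sum to zero ([reflected_gradients_cancel]), that is, the mean of the gradients
of [lam x + psi] is [lam]. By convexity, in the form of an affine minorant of
[excess] that touches it at [lam] ([excess_support]), the mean energy is at
least a multiple of [excess lam] ([effective_energy_ge_excess]). It remains to
find the edges of these triangles among the springs of the two materials, up to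
moving springs by lattice vectors ([kagome_effective_energy],
[squares_effective_energy]). *)

Set Implicit Arguments.
Unset Strict Implicit.
Unset Printing Implicit Defensive.

Import Order.TTheory GRing.Theory Num.Theory.

Local Open Scope ring_scope.

(** * Conformal and anticonformal part of a planar linear map *)

Section Planar.
Variable R : realType.
Implicit Types (F lam N : 'M[R]_2) (e x y : 'cV[R]_2).

Lemma sum_ord2 (V : nmodType) (f : 'I_2 -> V) : \sum_i f i = f 0 + f 1.
Proof.
by rewrite !big_ord_recl big_ord0 addr0; congr (_ + f _); apply/val_inj.
Qed.

Lemma det2 F : \det F = F 0 0 * F 1 1 - F 0 1 * F 1 0.
Proof.
rewrite (expand_det_row _ 0) sum_ord2 /cofactor !det_mx11 !mxE /=.
have l0 : lift (0 : 'I_2) 0 = 1 by apply/val_inj.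
have l1 : lift (1 : 'I_2) 0 = 0 by apply/val_inj.
by rewrite !l0 !l1 expr0 expr1; ring.
Qed.

Lemma enorm_sqr x : enorm x ^+ 2 = x 0 0 ^+ 2 + x 1 0 ^+ 2.
Proof. by rewrite /enorm sum_ord2 sqr_sqrtr // addr_ge0 ?sqr_ge0. Qed.

Lemma enorm_ge0 x : 0 <= enorm x.
Proof. exact: sqrtr_ge0. Qed.

Lemma enorm_opp x : enorm (- x) = enorm x.
Proof.
by rewrite /enorm; congr Num.sqrt; apply: eq_bigr => i _; rewrite mxE sqrrN.
Qed.

(** [|p|^2] and [|q|^2] when [F] is written as [z |-> p z + q conj(z)] on
the complex plane. *)
Definition conformal_sqr F : R :=
  ((F 0 0 + F 1 1) / 2) ^+ 2 + ((F 1 0 - F 0 1) / 2) ^+ 2.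
Definition anticonformal_sqr F : R :=
  ((F 0 0 - F 1 1) / 2) ^+ 2 + ((F 1 0 + F 0 1) / 2) ^+ 2.

Definition conformal F : R := Num.sqrt (conformal_sqr F).
Definition anticonformal F : R := Num.sqrt (anticonformal_sqr F).

Lemma conformal_sqrE F : conformal F ^+ 2 = conformal_sqr F.
Proof. by rewrite sqr_sqrtr // addr_ge0 ?sqr_ge0. Qed.

Lemma anticonformal_sqrE F : anticonformal F ^+ 2 = anticonformal_sqr F.
Proof. by rewrite sqr_sqrtr // addr_ge0 ?sqr_ge0. Qed.

Lemma det_conformal F : \det F = conformal F ^+ 2 - anticonformal F ^+ 2.
Proof.
rewrite conformal_sqrE anticonformal_sqrE det2.
rewrite /conformal_sqr /anticonformal_sqr.
by field.
Qed.

(** A convex function of [F] that vanishes exactly on the nonnegative multiples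
[t Q] of rotations with [t <= 1]. *)
Definition excess F : R :=
  anticonformal F ^+ 2 + pos_part (conformal F - 1) ^+ 2.

Definition stretch F e : R := enorm (F *m e) / enorm e.

(** With [e = exp(i theta)] the squared stretch is
[|p|^2 + |q|^2 + 2 Re(p conj(q) exp(2 i theta))]; the difference of the two
sides is the square of twice the corresponding imaginary part. *)
Lemma stretch_sqr F e : enorm e != 0 ->
  (stretch F e ^+ 2 - conformal F ^+ 2 - anticonformal F ^+ 2) ^+ 2 <=
  4 * conformal F ^+ 2 * anticonformal F ^+ 2.
Proof.
move=> e0; rewrite /stretch exprMn exprVn enorm_sqr !mxE !sum_ord2.
have n0 : e 0 0 ^+ 2 + e 1 0 ^+ 2 != 0 by rewrite -enorm_sqr expf_neq0.
rewrite enorm_sqr conformal_sqrE anticonformal_sqrE.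
rewrite /conformal_sqr /anticonformal_sqr.
move: n0; move: (F 0 0) (F 0 1) (F 1 0) (F 1 1) (e 0 0) (e 1 0).
move=> a b c d x y n0.
pose p1 := (a + d) / 2; pose p2 := (c - b) / 2.
pose q1 := (a - d) / 2; pose q2 := (c + b) / 2.
rewrite -subr_ge0.
set Z := (X in 0 <= X).
have -> : Z = ((2 * (p1 * q2 - p2 * q1) * (x ^+ 2 - y ^+ 2)
    - 4 * (p1 * q1 + p2 * q2) * (x * y)) / (x ^+ 2 + y ^+ 2)) ^+ 2.
  by rewrite /Z /p1 /p2 /q1 /q2; field.
exact: sqr_ge0.
Qed.

Lemma stretch_bounds F e : enorm e != 0 ->
  [/\ conformal F - anticonformal F <= stretch F e,
      anticonformal F - conformal F <= stretch F e &
      stretch F e <= conformal F + anticonformal F].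
Proof.
move=> /(stretch_sqr F).
have s0 : 0 <= stretch F e by rewrite divr_ge0 ?enorm_ge0.
have p0 : 0 <= conformal F by rewrite sqrtr_ge0.
have q0 : 0 <= anticonformal F by rewrite sqrtr_ge0.
move: (stretch F e) (conformal F) (anticonformal F) s0 p0 q0.
move=> s p q s0 p0 q0 h.
have pq0 : 0 <= 2 * p * q by rewrite !mulr_ge0.
have /andP[h1 h2] : - (2 * p * q) <= s ^+ 2 - p ^+ 2 - q ^+ 2 <= 2 * p * q.
  by rewrite -ler_norml -ler_sqr ?nnegrE // real_normK ?num_real //; lra.
split; nra.
Qed.

(** * The energy of one rigid triangle *)

(** The numbers [a <= b] stand for the smaller and the larger one of [|p|] and
[|q|], and the [ti] for the stretches of the edges. Since
[|ti^2 - tj^2| <= 4 b |ti - tj|], the factor [b^2] cancels from the last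
hypothesis, which leaves a bound on [a]; then [b] differs from [t1] by at most
[a]. *)
Lemma two_norms_near_one (a b t1 t2 t3 : R) :
  0 <= a -> a <= b ->
  0 <= t1 <= a + b -> 0 <= t2 <= a + b -> 0 <= t3 <= a + b ->
  b - a <= t1 ->
  8 * a ^+ 2 * b ^+ 2 <= (t1 ^+ 2 - t2 ^+ 2) ^+ 2 + (t1 ^+ 2 - t3 ^+ 2) ^+ 2
                         + (t2 ^+ 2 - t3 ^+ 2) ^+ 2 ->
  let d := (t1 - 1) ^+ 2 + (t2 - 1) ^+ 2 + (t3 - 1) ^+ 2 in
  a ^+ 2 <= 6 * d /\ (b - 1) ^+ 2 <= 14 * d.
Proof.
move=> a0 ab /andP[t10 t1b] /andP[t20 t2b] /andP[t30 t3b] bt h d.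
have diff (s t : R) : 0 <= s -> s <= a + b -> 0 <= t -> t <= a + b ->
    (s ^+ 2 - t ^+ 2) ^+ 2 <= 16 * b ^+ 2 * (s - t) ^+ 2.
  move=> s0 sb t0 tb; rewrite subr_sqr exprMn mulrC ler_wpM2r ?sqr_ge0 //.
  by nra.
have [b_eq0|b_neq0] := eqVneq b 0.
  have a_eq0 : a = 0 by lra.
  have t1_eq0 : t1 = 0 by lra.
  have t2_eq0 : t2 = 0 by lra.
  have t3_eq0 : t3 = 0 by lra.
  by rewrite /d a_eq0 b_eq0 t1_eq0 t2_eq0 t3_eq0; split; lra.
have b2 : 0 < b ^+ 2 by rewrite exprn_even_gt0.
have ha : a ^+ 2 <= 6 * d.
  rewrite -(ler_pM2l b2).
  have h12 := diff _ _ t10 t1b t20 t2b.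
  have h13 := diff _ _ t10 t1b t30 t3b.
  have h23 := diff _ _ t20 t2b t30 t3b.
  have le3d : (t1 - t2) ^+ 2 + (t1 - t3) ^+ 2 + (t2 - t3) ^+ 2 <= 3 * d.
    rewrite -subr_ge0 /d; set Z := (X in 0 <= X).
    have -> : Z = (t1 + t2 + t3 - 3) ^+ 2 by rewrite /Z; ring.
    exact: sqr_ge0.
  have := ler_wpM2l (ltW b2) le3d; move: h h12 h13 h23; rewrite /d; lra.
split=> //.
have le_d : (t1 - 1) ^+ 2 <= d by rewrite /d -addrA lerDl addr_ge0 ?sqr_ge0.
have : (b - 1) ^+ 2 <= 2 * a ^+ 2 + 2 * (t1 - 1) ^+ 2.
  have hab : (b - t1) ^+ 2 <= a ^+ 2 by nra.
  have := sqr_ge0 (b - 2 * t1 + 1); move: hab; lra.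
by lra.
Qed.

(** The inequality says that a map which stretches the three directions equally
is conformal or anticonformal, for which two directions are too few. The factor
[8] is the largest one that serves the right isosceles triangle. *)
Definition rigid_directions e1 e2 e3 : Prop :=
  [/\ 1 <= enorm e1, 1 <= enorm e2, 1 <= enorm e3 &
    forall F, 8 * conformal F ^+ 2 * anticonformal F ^+ 2 <=
      (stretch F e1 ^+ 2 - stretch F e2 ^+ 2) ^+ 2 +
      (stretch F e1 ^+ 2 - stretch F e3 ^+ 2) ^+ 2 +
      (stretch F e2 ^+ 2 - stretch F e3 ^+ 2) ^+ 2].

(** The energy of an edge is [|e|^2] times the squared deviation of the stretch
from [1]. *)
Lemma spring_stretch F e : 1 <= enorm e ->
  (stretch F e - 1) ^+ 2 <= (enorm (F *m e) - enorm e) ^+ 2.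
Proof.
move=> e1.
have e0 : enorm e != 0 by rewrite gt_eqF // (lt_le_trans ltr01).
have -> : enorm (F *m e) - enorm e = (stretch F e - 1) * enorm e.
  by rewrite mulrBl mul1r divfK.
rewrite exprMn ler_peMr ?sqr_ge0 //.
by rewrite exprn_ege1.
Qed.

(** If [0 < \det F] the anticonformal norm is the smaller one and
[two_norms_near_one] bounds both terms of the excess. Otherwise the excess is at
most [2 |q|^2 <= 4 + 4 (|q| - 1)^2]: the lemma bounds the last term and the
penalty is at least [1 / 4], which dictates the constant [56]. *)
Lemma excess_le_springs F e1 e2 e3 (area eta : R) :
  rigid_directions e1 e2 e3 -> 4^-1 <= area -> 0 < eta -> eta < 1 ->
  excess F <= 56 * ((enorm (F *m e1) - enorm e1) ^+ 2 +
                    (enorm (F *m e2) - enorm e2) ^+ 2 +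
                    (enorm (F *m e3) - enorm e3) ^+ 2 +
                    area * penalty eta (\det F)).
Proof.
move=> [e1_ge1 e2_ge1 e3_ge1 /(_ F) hF] area_ge eta0 eta1.
have nz e : 1 <= enorm e -> enorm e != 0 by move=> ?; rewrite gt_eqF //; lra.
have [pq1 qp1 s1] := stretch_bounds F (nz _ e1_ge1).
have [_ _ s2] := stretch_bounds F (nz _ e2_ge1).
have [_ _ s3] := stretch_bounds F (nz _ e3_ge1).
have sp e : 0 <= stretch F e by rewrite divr_ge0 ?enorm_ge0.
have /= := spring_stretch F e1_ge1; have /= := spring_stretch F e2_ge1.
have /= := spring_stretch F e3_ge1.
set E1 := (enorm (F *m e1) - _) ^+ 2; set E2 := (enorm (F *m e2) - _) ^+ 2.
set E3 := (enorm (F *m e3) - _) ^+ 2 => hE3 hE2 hE1.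
have p0 : 0 <= conformal F by rewrite sqrtr_ge0.
have q0 : 0 <= anticonformal F by rewrite sqrtr_ge0.
have posP (x y : R) : 0 <= y -> x <= y -> pos_part x ^+ 2 <= y ^+ 2.
  move=> y0 xy; rewrite ler_sqr ?nnegrE /pos_part ?le_max ?lexx ?orbT //.
  by rewrite ge_max xy y0.
have pos_sqr (x : R) : pos_part x ^+ 2 <= x ^+ 2.
  by rewrite -(real_normK (num_real x)) posP // ler_norm.
rewrite /excess /penalty det_conformal.
case: ifP => [det_le0|/negbT].
  have {det_le0}pq : conformal F <= anticonformal F.
    by rewrite -ler_sqr ?nnegrE // -subr_le0.
  have hp : pos_part (conformal F - 1) ^+ 2 <= anticonformal F ^+ 2.
    by apply: posP => //; lra.
  have [] := @two_norms_near_one (conformal F) (anticonformal F)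
    (stretch F e1) (stretch F e2) (stretch F e3) p0 pq.
  - by rewrite sp.
  - by rewrite sp.
  - by rewrite sp.
  - by [].
  - by [].
  move=> _ hq.
  have hq2 : anticonformal F ^+ 2 <= 2 * (anticonformal F - 1) ^+ 2 + 2.
    by have := sqr_ge0 (anticonformal F - 2); lra.
  have harea : 4^-1 <= area * eta^-1.
    rewrite -[4^-1]mulr1 ler_pM // ?invr_ge0 //.
    by rewrite invf_ge1 // ltW.
  by move: hp hq hq2 harea; lra.
rewrite -ltNge => det_gt0.
have {det_gt0}pq : anticonformal F <= conformal F.
  by rewrite -ler_sqr ?nnegrE // -subr_ge0 ltW.
have hp := pos_sqr (conformal F - 1).
have [] := @two_norms_near_one (anticonformal F) (conformal F)
  (stretch F e1) (stretch F e2) (stretch F e3) q0 pq.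
- by rewrite sp addrC.
- by rewrite sp addrC.
- by rewrite sp addrC.
- by [].
- by move: hF; lra.
have E_ge0 : 0 <= E1 + E2 + E3 by rewrite !addr_ge0 ?sqr_ge0.
by move: hp E_ge0; lra.
Qed.

(** * Convexity of the excess *)

(** The matrix [N] is a subgradient: the derivative of [|q|^2], plus
[2 (|p| - 1)_+] times the derivative of [|p|], which is the inner product
with the unit vector [p / |p|]. At [p = 0] the latter is multiplied by zero. *)
Lemma excess_support lam :
  exists N, forall F, excess lam + \tr (N *m (F - lam)) <= excess F.
Proof.
pose s := pos_part (conformal lam - 1).
pose p1 := (lam 0 0 + lam 1 1) / 2; pose p2 := (lam 1 0 - lam 0 1) / 2.
pose q1 := (lam 0 0 - lam 1 1) / 2; pose q2 := (lam 1 0 + lam 0 1) / 2.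
pose w1 := s * p1 / conformal lam; pose w2 := s * p2 / conformal lam.
exists (\matrix_(i, j) (if i == 0 then (if j == 0 then q1 + w1 else q2 + w2)
                        else (if j == 0 then q2 - w2 else w1 - q1))) => F.
rewrite /mxtrace sum_ord2 !mxE !sum_ord2 !mxE /=.
pose P1 := (F 0 0 + F 1 1) / 2; pose P2 := (F 1 0 - F 0 1) / 2.
pose Q1 := (F 0 0 - F 1 1) / 2; pose Q2 := (F 1 0 + F 0 1) / 2.
set T := (X in _ + X <= _).
have {T}-> : T = 2 * (q1 * (Q1 - q1) + q2 * (Q2 - q2)
                  + (w1 * (P1 - p1) + w2 * (P2 - p2))).
  by rewrite /T /q1 /q2 /p1 /p2 /Q1 /Q2 /P1 /P2; field.
(* The two summands of the excess are functions of [q] and of [p] alone. *)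
have hq : anticonformal lam ^+ 2 + 2 * (q1 * (Q1 - q1) + q2 * (Q2 - q2))
    <= anticonformal F ^+ 2.
  rewrite !anticonformal_sqrE /anticonformal_sqr -/q1 -/q2 -/Q1 -/Q2.
  by have := sqr_ge0 (Q1 - q1); have := sqr_ge0 (Q2 - q2); lra.
suff : s ^+ 2 + 2 * (w1 * (P1 - p1) + w2 * (P2 - p2))
    <= pos_part (conformal F - 1) ^+ 2.
  by move: hq; rewrite /excess -/s; lra.
have r_ge : conformal F - 1 <= pos_part (conformal F - 1).
  by rewrite /pos_part le_max lexx.
have r_ge0 : 0 <= pos_part (conformal F - 1).
  by rewrite /pos_part le_max lexx orbT.
have s_ge0 : 0 <= s by rewrite /s /pos_part le_max lexx orbT.
move: (pos_part (conformal F - 1)) r_ge r_ge0 => r r_ge r_ge0.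
(* [(w1, w2)] is [s p / |p|] and vanishes with [s]. *)
have [s0|s_neq0] := eqVneq s 0.
  by rewrite /w1 /w2 s0 !(mul0r, mulr0) addr0 expr0n mulr0 addr0 sqr_ge0.
have s_eq : s = conformal lam - 1.
  move: s_neq0; rewrite /s /pos_part.
  by case: (leP (conformal lam - 1) 0) => //; rewrite eqxx.
have p_gt0 : 0 < conformal lam by lra.
have p2E : conformal lam ^+ 2 = p1 ^+ 2 + p2 ^+ 2 by rewrite conformal_sqrE.
have P2E : conformal F ^+ 2 = P1 ^+ 2 + P2 ^+ 2 by rewrite conformal_sqrE.
have P_ge0 : 0 <= conformal F by rewrite sqrtr_ge0.
have cs : p1 * P1 + p2 * P2 <= conformal lam * conformal F.
  apply: le_trans (ler_norm _) _.
  rewrite -ler_sqr ?nnegrE ?mulr_ge0 // ?(ltW p_gt0) //.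
  rewrite real_normK ?num_real // exprMn p2E P2E.
  by have := sqr_ge0 (p1 * P2 - p2 * P1); lra.
have {}cs : w1 * (P1 - p1) + w2 * (P2 - p2) <=
    s * (conformal F - conformal lam).
  have -> : w1 * (P1 - p1) + w2 * (P2 - p2) =
      s * ((p1 * P1 + p2 * P2 - (p1 ^+ 2 + p2 ^+ 2)) / conformal lam).
    by rewrite /w1 /w2; field; rewrite gt_eqF.
  rewrite ler_wpM2l // ler_pdivrMr // -p2E; move: cs; lra.
have pE : conformal lam = s + 1 by lra.
have := ler_wpM2l s_ge0 r_ge; have := sqr_ge0 (r - s).
by move: cs; rewrite pE; lra.
Qed.

End Planar.

(** * Principal stretches *)

Section Stretches.
Variable R : realType.
Implicit Types (lam U : 'M[R]_2) (l : R).

Lemma psd_eigenvalue_ge0 U l :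
  (forall x : 'cV[R]_2, 0 <= (x^T *m U *m x) 0 0) ->
  root (char_poly U) l -> 0 <= l.
Proof.
move=> psdU; rewrite -eigenvalue_root_char => /eigenvalueP[v vU v0].
have := psdU v^T; rewrite trmxK vU -scalemxAl mxE.
suff : 0 < (v *m v^T) 0 0 by move=> vv; rewrite pmulr_lge0.
rewrite mxE sum_ord2 !mxE -!expr2 lt0r addr_ge0 ?sqr_ge0 // andbT.
rewrite paddr_eq0 ?sqr_ge0 // !sqrf_eq0.
apply: contra v0 => /andP[/eqP v0 /eqP v1].
apply/eqP/rowP => i; rewrite mxE.
have [->|->] // : i = 0 \/ i = 1.
by case: i => -[|[|//]] ?; [left|right]; apply/val_inj.
Qed.

(** Trace and determinant of the square root [U] and of [U *m U = lam^T *m lam]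
give the two symmetric functions of the stretches. *)
Lemma principal_stretchesP lam l1 l2 : principal_stretches lam l1 l2 ->
  [/\ 0 <= l1, 0 <= l2, l1 * l2 = `|\det lam| &
      l1 ^+ 2 + l2 ^+ 2 = 2 * (conformal lam ^+ 2 + anticonformal lam ^+ 2)].
Proof.
move=> [U [symU psdU sqU chU]].
have l1_ge0 : 0 <= l1.
  by apply: psd_eigenvalue_ge0 psdU _; rewrite chU rootM root_XsubC eqxx.
have l2_ge0 : 0 <= l2.
  apply: psd_eigenvalue_ge0 psdU _.
  by rewrite chU rootM !root_XsubC eqxx orbT.
have detU : \det U = l1 * l2.
  have := char_poly_det U; rewrite chU sqrrN expr1n mul1r => <-.
  by rewrite -horner_coef0 hornerM !hornerXsubC; ring.
have trU : \tr U = l1 + l2.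
  apply: oppr_inj; rewrite -char_poly_trace // chU coefM sum_ord2.
  rewrite !coefB !coefX !coefC /=.
  by ring.
have sqdet : \det U ^+ 2 = \det lam ^+ 2.
  by rewrite !expr2 -{2}(det_tr lam) -!det_mulmx sqU det_mulmx mulrC -det_mulmx.
split=> //.
  apply/eqP; rewrite -(eqrXn2 (n := 2)) ?mulr_ge0 // -detU sqdet.
  by rewrite real_normK ?num_real.
have : \tr (U *m U) = \tr (lam^T *m lam) by rewrite sqU.
rewrite /mxtrace !sum_ord2 !mxE !sum_ord2 !mxE.
rewrite conformal_sqrE anticonformal_sqrE /conformal_sqr /anticonformal_sqr.
move: detU trU; rewrite det2 /mxtrace sum_ord2.
have -> : U 1 0 = U 0 1 by rewrite -{1}symU mxE.
move=> dU tU h.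
have -> : l1 ^+ 2 + l2 ^+ 2 = (l1 + l2) ^+ 2 - 2 * (l1 * l2) by ring.
by rewrite -tU -dU; move: h; lra.
Qed.

(** The product and the sum of squares force [{l1, l2}] to be
[{|p| + |q|, ||p| - |q||}]. *)
Lemma stretches_le_excess lam l1 l2 : principal_stretches lam l1 l2 ->
  (0 <= \det lam ->
   (l1 - l2) ^+ 2 + pos_part (l1 - 1) ^+ 2 + pos_part (l2 - 1) ^+ 2
     <= 8 * excess lam) /\
  (\det lam < 0 ->
   (l1 + l2) ^+ 2 + pos_part (l1 - 1) ^+ 2 + pos_part (l2 - 1) ^+ 2
     <= 8 * excess lam).
Proof.
move=> /principal_stretchesP[l1_ge0 l2_ge0 prod sum].
have p0 : 0 <= conformal lam by rewrite sqrtr_ge0.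
have q0 : 0 <= anticonformal lam by rewrite sqrtr_ge0.
move: prod sum; rewrite /excess det_conformal.
move: (conformal lam) (anticonformal lam) p0 q0 => p q p0 q0 prod sum.
have pos (l : R) : l <= p + q ->
    pos_part (l - 1) ^+ 2 <= 2 * pos_part (p - 1) ^+ 2 + 2 * q ^+ 2.
  move=> lpq.
  have r_ge : p - 1 <= pos_part (p - 1) by rewrite /pos_part le_max lexx.
  have r_ge0 : 0 <= pos_part (p - 1) by rewrite /pos_part le_max lexx orbT.
  have le_rq : pos_part (l - 1) <= pos_part (p - 1) + q.
    by rewrite {1}/pos_part ge_max addr_ge0 // andbT; lra.
  have l_ge0 : 0 <= pos_part (l - 1) by rewrite /pos_part le_max lexx orbT.
  by have := sqr_ge0 (pos_part (p - 1) - q); nra.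
have r2 : 0 <= pos_part (p - 1) ^+ 2 by exact: sqr_ge0.
split=> det_sgn.
  rewrite ger0_norm // in prod.
  have diff : (l1 - l2) ^+ 2 = 4 * q ^+ 2.
    have -> : (l1 - l2) ^+ 2 = l1 ^+ 2 + l2 ^+ 2 - 2 * (l1 * l2) by ring.
    by rewrite sum prod; ring.
  have l12 : l1 + l2 = 2 * p.
    apply/eqP; rewrite -(eqrXn2 (n := 2)) ?addr_ge0 ?mulr_ge0 //; apply/eqP.
    have -> : (l1 + l2) ^+ 2 = l1 ^+ 2 + l2 ^+ 2 + 2 * (l1 * l2) by ring.
    by rewrite sum prod; ring.
  have h1 : l1 <= p + q by nra.
  have h2 : l2 <= p + q by nra.
  by have := pos _ h1; have := pos _ h2; rewrite diff; lra.
rewrite ltr0_norm // in prod.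
have diff : (l1 - l2) ^+ 2 = 4 * p ^+ 2.
  have -> : (l1 - l2) ^+ 2 = l1 ^+ 2 + l2 ^+ 2 - 2 * (l1 * l2) by ring.
  by rewrite sum prod; ring.
have l12 : l1 + l2 = 2 * q.
  apply/eqP; rewrite -(eqrXn2 (n := 2)) ?addr_ge0 ?mulr_ge0 //; apply/eqP.
  have -> : (l1 + l2) ^+ 2 = l1 ^+ 2 + l2 ^+ 2 + 2 * (l1 * l2) by ring.
  by rewrite sum prod; ring.
have h1 : l1 <= p + q by nra.
have h2 : l2 <= p + q by nra.
by have := pos _ h1; have := pos _ h2; rewrite l12; lra.
Qed.

End Stretches.

(** * Sums over a period *)

Section Lattice.
Variables (R : realType) (M : metamaterial R).
Implicit Types (u psi : 'cV[R]_2 -> 'cV[R]_2) (eta : R) (lam F : 'M[R]_2).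
Implicit Types (A B O P Q W x : 'cV[R]_2).

Definition shift (a b : nat) : 'cV[R]_2 := lat1 M *+ a + lat2 M *+ b.

Lemma sum_cyclic (V : nmodType) (k : nat) (g : nat -> V) :
  g k = g 0%N -> \sum_(a < k) g a.+1 = \sum_(a < k) g a.
Proof.
case: k => [|k] gk; first by rewrite !big_ord0.
by rewrite big_ord_recr big_ord_recl /= gk addrC.
Qed.

Section TorusSums.
Variables (k : nat) (psi : 'cV[R]_2 -> 'cV[R]_2) (V : nmodType).
Variable h : 'cV[R]_2 -> 'cV[R]_2 -> V.
Hypothesis psi_per : periodic M k psi.

(** Two points are needed so that [h] can be the energy of a spring; only
nodes matter, because a periodic deformation is unconstrained elsewhere. *)
Definition torus_sum P Q : V :=
  \sum_(a < k) \sum_(b < k) h (psi (P + shift a b)) (psi (Q + shift a b)).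

Lemma torus_sum_lat1 P Q : nodes M P -> nodes M Q ->
  torus_sum (P + lat1 M) (Q + lat1 M) = torus_sum P Q.
Proof.
move=> nP nQ; rewrite /torus_sum.
pose g a := \sum_(b < k) h (psi (P + shift a b)) (psi (Q + shift a b)).
rewrite -[RHS](@sum_cyclic V k g); last first.
  apply: eq_bigr => b _; rewrite /shift mulr0n add0r.
  have per x : nodes M x ->
      psi (x + (lat1 M *+ k + lat2 M *+ b)) = psi (x + lat2 M *+ b).
    move=> nx; rewrite (addrC (_ *+ k)) addrA.
    have := nodesD 0 b nx; rewrite mulr0n add0r.
    by move=> /psi_per[].
  by rewrite !per.
by apply: eq_bigr => a _; apply: eq_bigr => b _; rewrite /shift !mulrS !addrA.
Qed.

Lemma torus_sum_lat2 P Q : nodes M P -> nodes M Q ->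
  torus_sum (P + lat2 M) (Q + lat2 M) = torus_sum P Q.
Proof.
move=> nP nQ; rewrite /torus_sum; apply: eq_bigr => a _.
pose g b := h (psi (P + shift a b)) (psi (Q + shift a b)).
rewrite -[RHS](@sum_cyclic V k g); last first.
  rewrite /g /shift mulr0n addr0.
  have per x : nodes M x ->
      psi (x + (lat1 M *+ a + lat2 M *+ k)) = psi (x + lat1 M *+ a).
    move=> nx; rewrite addrA.
    have := nodesD a 0 nx; rewrite mulr0n addr0.
    by move=> /psi_per[].
  by rewrite !per.
apply: eq_bigr => b _; rewrite /g /shift.
have next x : x + lat2 M + (lat1 M *+ a + lat2 M *+ b) =
    x + (lat1 M *+ a + lat2 M *+ b.+1).
  by rewrite mulrS (addrCA (lat1 M *+ a)) !addrA.
by rewrite !next.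
Qed.

End TorusSums.

(** * Energies and gradients of triangles *)

Definition edge_energy u P Q : R := (enorm (u P - u Q) - enorm (P - Q)) ^+ 2.

Lemma edge_energy_ge0 u P Q : 0 <= edge_energy u P Q.
Proof. exact: sqr_ge0. Qed.

Lemma edge_energyC u P Q : edge_energy u P Q = edge_energy u Q P.
Proof. by rewrite /edge_energy -enorm_opp opprB -(enorm_opp (P - Q)) opprB. Qed.

Definition triangle_energy eta u (T : triangle R) : R :=
  let: (P, Q, W) := T in
  edge_energy u P Q + edge_energy u P W + edge_energy u Q W +
  triangle_area T * penalty eta (\det (affine_gradient u T)).

Definition rigid_triangle (T : triangle R) : Prop :=
  let: (P, Q, W) := T in
  [/\ rigid_directions (P - Q) (P - W) (Q - W), 4^-1 <= triangle_area T &
      \det (edge_mx P Q W) != 0].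

Lemma affine_gradient_edges u P Q W (F := affine_gradient u (P, Q, W)) :
  \det (edge_mx P Q W) != 0 ->
  [/\ F *m (P - Q) = u P - u Q, F *m (P - W) = u P - u W &
      F *m (Q - W) = u Q - u W].
Proof.
move=> nz; have [_ /(_ (erefl F))[b [<- <- <-]]] := affine_gradientP u F nz.
have cancel x y : x + b - (y + b) = x - y by rewrite opprD addrACA subrr addr0.
by rewrite !mulmxBr !cancel.
Qed.

Lemma excess_le_triangle_energy eta u T :
  0 < eta -> eta < 1 -> rigid_triangle T ->
  excess (affine_gradient u T) <= 56 * triangle_energy eta u T.
Proof.
case: T => -[P Q] W eta0 eta1 [rig area nz].
have := excess_le_springs (affine_gradient u (P, Q, W)) rig area eta0 eta1.
by have [-> -> ->] := affine_gradient_edges u nz.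
Qed.

Lemma affine_gradient_swap u P Q W : \det (edge_mx P Q W) != 0 ->
  \det (edge_mx W Q P) != 0 ->
  affine_gradient u (P, Q, W) = affine_gradient u (W, Q, P).
Proof.
move=> nz nz'; apply/(affine_gradientP _ _ nz').
set F := affine_gradient u (P, Q, W).
by have [_ /(_ erefl)[b []]] := affine_gradientP u F nz; exists b.
Qed.

Lemma affine_gradient_affine lam psi t P Q W :
  \det (edge_mx P Q W) != 0 ->
  affine_gradient (fun x => lam *m (x + t) + psi (x + t)) (P, Q, W) =
  lam + affine_gradient (fun x => psi (x + t)) (P, Q, W).
Proof.
move=> nz; apply/esym/(affine_gradientP _ _ nz).
set v := fun x => psi (x + t); set F := affine_gradient v (P, Q, W).
have [_ /(_ erefl)[b [hP hQ hW]]] := affine_gradientP v F nz.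
rewrite /v in hP hQ hW.
exists (lam *m t + b); rewrite -hP -hQ -hW.
by split; rewrite mulmxDl mulmxDr addrACA.
Qed.

Lemma edge_mxE P Q W i j :
  edge_mx P Q W i j = if j == 0 then (Q - P) i 0 else (W - P) i 0.
Proof.
by rewrite mxE; case: splitP => l; rewrite (ord1 l) -val_eqE /= => ->.
Qed.

(** The gradient is linear in the deformation, so the sum over the cells of
the gradients of [psi] is the gradient of the sum of [psi] over the cells. *)
Lemma affine_gradient_sum (I : finType) (u : I -> 'cV[R]_2 -> 'cV[R]_2)
    (T : triangle R) :
  \sum_i affine_gradient (u i) T = affine_gradient (fun x => \sum_i u i x) T.
Proof.
case: T => -[P Q] W; rewrite /affine_gradient -mulmx_suml; congr (_ *m _).
apply/matrixP => i j; rewrite summxE edge_mxE.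
under eq_bigr do rewrite edge_mxE.
case: ifP => _; rewrite 2!mxE !summxE -sumrB;
  by apply: eq_bigr => m _; rewrite 2!mxE.
Qed.

(** The reflection at [O] maps [A] to [A'] and [B] to [B']. As [u] takes the
same values at these points, the affine interpolants on the two triangles are
carried into each other by the reflection, and their gradients are opposite. *)
Lemma reflected_gradients_cancel u A O B A' B' :
  A + A' = O + O -> B + B' = O + O -> u A = u A' -> u B = u B' ->
  \det (edge_mx A O B) != 0 -> \det (edge_mx A' O B') != 0 ->
  affine_gradient u (A, O, B) + affine_gradient u (A', O, B') = 0.
Proof.
move=> hA hB uA uB nz nz'.
apply/eqP; rewrite addr_eq0; apply/eqP/esym.
apply/(affine_gradientP _ _ nz).
set F := affine_gradient u (A', O, B').
have [_ /(_ erefl)[b [hA' hO hB']]] := affine_gradientP u F nz'.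
exists (F *m (O + O) + b); rewrite uA uB -hA' -hO -hB' !addrA !mulNmx -!mulmxN.
rewrite -!mulmxDr addKr.
by rewrite -{1}hA -hB !addKr.
Qed.

End Lattice.

(** * Lower bound of the effective energy *)

(* Simplification would expose the edge matrices. *)
#[local] Arguments affine_gradient : simpl never.
#[local] Arguments triangle_area : simpl never.

Section Homogenization.
Variables (R : realType) (M : metamaterial R).
Implicit Types (u psi : 'cV[R]_2 -> 'cV[R]_2) (eta : R) (lam F : 'M[R]_2).
Implicit Types (A B O P Q W x e : 'cV[R]_2).

(** Congruence of node pairs modulo the lattice. Shifts by natural multiples on
both sides cover all lattice vectors. *)
Definition congruent P Q P' Q' : Prop :=
  [/\ nodes M P, nodes M Q, nodes M P' & nodes M Q'] /\
  exists a b a' b', P + shift M a b = P' + shift M a' b' /\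
                    Q + shift M a b = Q' + shift M a' b'.

Lemma torus_sum_shift k psi (V : nmodType) (h : 'cV[R]_2 -> 'cV[R]_2 -> V)
    P Q a b :
  periodic M k psi -> nodes M P -> nodes M Q ->
  torus_sum M k psi h (P + shift M a b) (Q + shift M a b) =
  torus_sum M k psi h P Q.
Proof.
move=> per nP nQ; elim: b => [|b IHb].
  elim: a => [|a IHa]; first by rewrite /shift !mulr0n !addr0.
  rewrite -IHa -[RHS](torus_sum_lat1 h per); try exact: nodesD.
  by rewrite /shift !mulr0n !addr0 mulrSr !addrA.
rewrite -IHb -[RHS](torus_sum_lat2 h per); try exact: nodesD.
by rewrite /shift mulrSr !addrA.
Qed.

Lemma torus_sum_congruent k psi (V : nmodType) (h : 'cV[R]_2 -> 'cV[R]_2 -> V)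
    P Q P' Q' :
  periodic M k psi -> congruent P Q P' Q' ->
  torus_sum M k psi h P Q = torus_sum M k psi h P' Q'.
Proof.
move=> per [[nP nQ nP' nQ'] [a [b [a' [b' [hP hQ]]]]]].
by rewrite -(torus_sum_shift h a b per) // hP hQ torus_sum_shift.
Qed.

Definition cell_deformation lam psi (a b : nat) x : 'cV[R]_2 :=
  lam *m (x + shift M a b) + psi (x + shift M a b).

(** A spring may be moved by a lattice vector: its energy depends on [lam] only
through [P - Q], and on [psi] only through the two values at the nodes. *)
Lemma sum_edge_energy_congruent k lam psi P Q P' Q' :
  periodic M k psi -> congruent P Q P' Q' ->
  \sum_(a < k) \sum_(b < k) edge_energy (cell_deformation lam psi a b) P Q =
  \sum_(a < k) \sum_(b < k) edge_energy (cell_deformation lam psi a b) P' Q'.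
Proof.
move=> per PQ.
have PQ' : P - Q = P' - Q'.
  have [_ [a [b [a' [b' [hP hQ]]]]]] := PQ.
  have cancel x y z : x + z - (y + z) = x - y.
    by rewrite opprD addrACA subrr addr0.
  by rewrite -(cancel P Q (shift M a b)) hP hQ cancel.
pose h x y := (enorm (lam *m (P - Q) + (x - y)) - enorm (P - Q)) ^+ 2.
have hE a b X Y : X - Y = P - Q ->
    edge_energy (cell_deformation lam psi a b) X Y =
    h (psi (X + shift M a b)) (psi (Y + shift M a b)).
  move=> XY; rewrite /edge_energy /h /cell_deformation -XY !mulmxBr.
  congr ((enorm _ - _) ^+ 2); rewrite !mulmxDr.
  by apply/matrixP => i j; rewrite !mxE; ring.
have := torus_sum_congruent h per PQ; rewrite /torus_sum => E.
have -> : \sum_(a < k) \sum_(b < k)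
      edge_energy (cell_deformation lam psi a b) P Q =
    \sum_(a < k) \sum_(b < k) h (psi (P + shift M a b)) (psi (Q + shift M a b)).
  by apply: eq_bigr => a _; apply: eq_bigr => b _; rewrite hE.
by rewrite E; apply: eq_bigr => a _; apply: eq_bigr => b _; rewrite hE.
Qed.

Lemma rigid_directions_opp e1 e2 e3 :
  rigid_directions e1 e2 e3 -> rigid_directions (- e1) (- e2) (- e3).
Proof.
move=> [h1 h2 h3 h]; rewrite /rigid_directions !enorm_opp; split=> // F.
have so e : stretch F (- e) = stretch F e by rewrite /stretch mulmxN !enorm_opp.
by rewrite !so.
Qed.

Lemma rigid_triangle_reflect A O B A' B' :
  A + A' = O + O -> B + B' = O + O ->
  rigid_triangle (A, O, B) -> rigid_triangle (A', O, B').
Proof.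
move=> hA hB [rig area nz].
have eA : A' = O + O - A by rewrite -hA addrC addKr.
have eB : B' = O + O - B by rewrite -hB addrC addKr.
have E : edge_mx A' O B' = - edge_mx A O B.
  apply/matrixP => i j; rewrite [RHS]mxE !edge_mxE eA eB !mxE.
  by case: ifP => _; ring.
have detE : \det (edge_mx A' O B') = \det (edge_mx A O B).
  rewrite E !det2; move: (edge_mx A O B) => X; by rewrite !mxE; ring.
split; last by rewrite detE.
  have -> : A' - O = - (A - O).
    by rewrite eA; apply/matrixP => i j; rewrite !mxE; ring.
  have -> : A' - B' = - (A - B).
    by rewrite eA eB; apply/matrixP => i j; rewrite !mxE; ring.
  have -> : O - B' = - (O - B).
    by rewrite eB; apply/matrixP => i j; rewrite !mxE; ring.
  exact: rigid_directions_opp.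
by rewrite /triangle_area detE.
Qed.

Lemma effective_energy_ge eta lam (c : R) :
  (forall k psi, (0 < k)%N -> periodic M k psi ->
     c <= mean_energy M eta lam k psi) ->
  c <= effective_energy M eta lam.
Proof.
move=> h; apply: lb_le_inf.
  by eexists; exists 1%N.
move=> _ [k /= k0 <-]; apply: lb_le_inf.
  by exists (mean_energy M eta lam k (fun=> 0)); exists (fun=> 0).
by move=> _ [psi per <-]; exact: h.
Qed.

(** Jensen's inequality: [56] times each triangle energy is at least the affine
minorant of the excess at [lam], and the linear parts cancel in the sum over
the cells. *)
Lemma sum_excess_le_triangle_energy k eta lam psi A O B A' B' :
  0 < eta -> eta < 1 -> periodic M k psi ->
  A + A' = O + O -> B + B' = O + O -> rigid_triangle (A, O, B) ->
  congruent A A A' A' -> congruent B B B' B' ->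
  2 * k%:R ^+ 2 * excess lam <=
  56 * \sum_(a < k) \sum_(b < k)
     (triangle_energy eta (cell_deformation lam psi a b) (A, O, B) +
      triangle_energy eta (cell_deformation lam psi a b) (A', O, B')).
Proof.
move=> eta0 eta1 per hA hB rig cA cB.
have rig' := rigid_triangle_reflect hA hB rig.
have [_ _ nz] := rig; have [_ _ nz'] := rig'.
have [N hN] := excess_support lam.
pose G a b := affine_gradient (fun x => psi (x + shift M a b)) (A, O, B) +
              affine_gradient (fun x => psi (x + shift M a b)) (A', O, B').
have G0 : \sum_(a < k) \sum_(b < k) G a b = 0.
  rewrite -[RHS](@reflected_gradients_cancel R
    (fun x => \sum_(a < k) \sum_(b < k) psi (x + shift M a b)) A O B A' B') //.
  - rewrite -!affine_gradient_sum -big_split; apply: eq_bigr => a _ /=.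
    by rewrite -!affine_gradient_sum -big_split.
  - exact: (torus_sum_congruent (fun x _ => x) per cA).
  - exact: (torus_sum_congruent (fun x _ => x) per cB).
have -> : 2 * k%:R ^+ 2 * excess lam =
    \sum_(a < k) \sum_(b < k) (2 * excess lam + \tr (N *m G a b)).
  have trG0 : \sum_(a < k) \sum_(b < k) \tr (N *m G a b) = 0.
    transitivity (\tr (N *m \sum_(a < k) \sum_(b < k) G a b)); last first.
      by rewrite G0 mulmx0 raddf0.
    rewrite mulmx_sumr raddf_sum; apply: eq_bigr => a _.
    by rewrite mulmx_sumr raddf_sum.
  under eq_bigr do rewrite big_split /= sumr_const card_ord.
  rewrite big_split /= trG0 addr0.
  by rewrite sumr_const card_ord -mulrnA -[RHS]mulr_natr natrM; ring.
rewrite mulr_sumr; apply: ler_sum => a _.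
rewrite mulr_sumr; apply: ler_sum => b _.
set u := cell_deformation lam psi a b.
have h1 := excess_le_triangle_energy u eta0 eta1 rig.
have h2 := excess_le_triangle_energy u eta0 eta1 rig'.
move: h1 h2; rewrite /u /cell_deformation !affine_gradient_affine // -/u.
rewrite /G mulmxDr raddfD /=.
set g1 := affine_gradient _ (A, O, B); set g2 := affine_gradient _ (A', O, B').
have := hN (lam + g1); have := hN (lam + g2).
by rewrite !(addrC lam) !addrK; lra.
Qed.

(** The last hypothesis says that the springs and penalties of the two
triangles, moved by lattice vectors where necessary, are among those of the
material. *)
Lemma effective_energy_ge_excess eta lam A O B A' B' :
  0 < eta -> eta < 1 -> 0 < cell_area M ->
  A + A' = O + O -> B + B' = O + O -> rigid_triangle (A, O, B) ->
  congruent A A A' A' -> congruent B B B' B' ->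
  (forall k psi, periodic M k psi ->
     \sum_(a < k) \sum_(b < k)
       (triangle_energy eta (cell_deformation lam psi a b) (A, O, B) +
        triangle_energy eta (cell_deformation lam psi a b) (A', O, B')) <=
     \sum_(a < k) \sum_(b < k)
       cell_energy M eta (fun x => lam *m x + psi x) a b) ->
  excess lam / (28 * cell_area M) <= effective_energy M eta lam.
Proof.
move=> eta0 eta1 area0 hA hB rig cA cB hE.
apply: effective_energy_ge => k psi k0 per.
have k2 : 0 < k%:R ^+ 2 :> R by rewrite exprn_gt0 // ltr0n.
rewrite /mean_energy ler_pdivlMr; last exact: mulr_gt0.
have -> : excess lam / (28 * cell_area M) * (k%:R ^+ 2 * cell_area M) =
   (2 * k%:R ^+ 2 * excess lam) / 56 by field; rewrite gt_eqF.
rewrite ler_pdivrMr // [X in _ <= X]mulrC.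
apply: le_trans
  (sum_excess_le_triangle_energy lam eta0 eta1 per hA hB rig cA cB) _.
by rewrite ler_wpM2l // hE.
Qed.

End Homogenization.

(** * The rigid triangles of the two materials *)

Section Materials.
Variable R : realType.
Implicit Types (F lam : 'M[R]_2) (e : 'cV[R]_2).

(** The entries of [F^T *m F]; both sides of the inequality in
[rigid_directions] are polynomials in them. *)
Definition gram00 F : R := F 0 0 ^+ 2 + F 1 0 ^+ 2.
Definition gram11 F : R := F 0 1 ^+ 2 + F 1 1 ^+ 2.
Definition gram01 F : R := F 0 0 * F 0 1 + F 1 0 * F 1 1.

Lemma stretch_pt F (x y : R) :
  stretch F (pt x y) ^+ 2 =
  (gram00 F * x ^+ 2 + 2 * gram01 F * (x * y) + gram11 F * y ^+ 2)
    / (x ^+ 2 + y ^+ 2).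
Proof.
rewrite /stretch exprMn exprVn !enorm_sqr !mxE !sum_ord2 !mxE /=; congr (_ / _).
by rewrite /gram00 /gram01 /gram11; ring.
Qed.

Lemma conformal_gram F :
  4 * conformal F ^+ 2 * anticonformal F ^+ 2 =
  ((gram00 F - gram11 F) / 2) ^+ 2 + gram01 F ^+ 2.
Proof.
rewrite conformal_sqrE anticonformal_sqrE /conformal_sqr /anticonformal_sqr.
by rewrite /gram00 /gram11 /gram01; field.
Qed.

Lemma enorm_pt_ge1 (x y : R) : 1 <= x ^+ 2 + y ^+ 2 -> 1 <= enorm (pt x y).
Proof.
move=> h; rewrite -ler_sqr ?nnegrE ?enorm_ge0 // expr1n enorm_sqr !mxE //.
Qed.

Lemma det_pt (a b c d e f : R) :
  \det (edge_mx (pt a b) (pt c d) (pt e f)) =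
  (c - a) * (f - b) - (e - a) * (d - b).
Proof. by rewrite det2 !edge_mxE !mxE /=; ring. Qed.

Lemma ptB (a b c d : R) : pt a b - pt c d = pt (a - c) (b - d).
Proof. by apply/matrixP => i j; rewrite !mxE; case: ifP. Qed.

Lemma ptD (a b c d : R) : pt a b + pt c d = pt (a + c) (b + d).
Proof. by apply/matrixP => i j; rewrite !mxE; case: ifP. Qed.

Let s : R := Num.sqrt 3.

Lemma sqrt3_sqr : s ^+ 2 = 3.
Proof. by rewrite sqr_sqrtr. Qed.

Lemma kagome_triangle_rigid :
  rigid_triangle (pt (1 / 2) (s / 2), pt 0 0, pt (- (1 / 2)) (s / 2)).
Proof.
have s2 := sqrt3_sqr.
have s_ge1 : 1 <= s by rewrite -ler_sqr ?nnegrE ?sqrtr_ge0 // s2; lra.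
have detE :
    \det (edge_mx (pt (1 / 2) (s / 2)) (pt 0 0) (pt (- (1 / 2)) (s / 2)))
    = - (s / 2) by rewrite det_pt; field.
split.
- rewrite !ptB; split.
  + by apply: enorm_pt_ge1; move: s2; lra.
  + by apply: enorm_pt_ge1; move: s2; lra.
  + by apply: enorm_pt_ge1; move: s2; lra.
  + move=> F; rewrite !stretch_pt.
    have := conformal_gram F.
    set L := gram00 F; set N := gram01 F; set K := gram11 F => pqE.
    have -> : (1 / 2 - 0) ^+ 2 + (s / 2 - 0) ^+ 2 = 1 by move: s2; lra.
    have -> : (1 / 2 - - (1 / 2)) ^+ 2 + (s / 2 - s / 2) ^+ 2 = 1 :> R by field.
    have -> : (0 - - (1 / 2)) ^+ 2 + (0 - s / 2) ^+ 2 = 1 by move: s2; lra.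
    set S := (X in _ <= X).
    have -> : S = 9 / 8 * (L - K) ^+ 2 + 9 / 2 * N ^+ 2.
      (* [s ^+ 2] stays symbolic until [sqrt3_sqr] can replace it. *)
      transitivity (3 / 2 * s ^+ 2 * N ^+ 2 +
                    2 * (s ^+ 2 / 4 * K - 3 / 4 * L) ^+ 2).
        by rewrite /S; field.
      by rewrite s2; field.
    have := sqr_ge0 (L - K); have := sqr_ge0 N; move: pqE; lra.
- rewrite /triangle_area detE normrN ger0_norm; lra.
- by rewrite detE; apply/eqP; lra.
Qed.

Lemma squares_triangle_rigid :
  rigid_triangle (pt (- 1) 1, pt 0 0, pt 0 1 : 'cV[R]_2).
Proof.
have detE : \det (edge_mx (pt (- 1) 1) (pt 0 0) (pt 0 1)) = 1 :> R.
  by rewrite det_pt; ring.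
split.
- rewrite !ptB; split.
  + by apply: enorm_pt_ge1; lra.
  + by apply: enorm_pt_ge1; lra.
  + by apply: enorm_pt_ge1; lra.
  + move=> F; rewrite !stretch_pt.
    have := conformal_gram F.
    set L := gram00 F; set N := gram01 F; set K := gram11 F => pqE.
    set S := (X in _ <= X).
    have -> : S = 3 / 2 * (L - K) ^+ 2 + 2 * N ^+ 2 by rewrite /S; field.
    have := sqr_ge0 (L - K); move: pqE; lra.
- rewrite /triangle_area detE normr1; lra.
- by rewrite detE oner_eq0.
Qed.

End Materials.

(** * The springs of the two materials *)

Section Cells.
Variable R : realType.
Implicit Types (u psi : 'cV[R]_2 -> 'cV[R]_2) (lam : 'M[R]_2).

Definition triangle_penalty eta u (T : triangle R) : R :=
  triangle_area T * penalty eta (\det (affine_gradient u T)).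

Section Kagome.
Let s : R := Num.sqrt 3.
Let O : 'cV[R]_2 := pt 0 0.
Let A := pt (1 / 2) (s / 2).
Let B := pt (- (1 / 2)) (s / 2).
Let C := pt (- (1 / 2)) (- (s / 2)).
Let D := pt (1 / 2) (- (s / 2)).
Let E := pt (3 / 2) (- (s / 2)).
Let F := pt (3 / 2) (s / 2).

Lemma kagome_energyE eta u :
  energy (kagome R) eta u =
  edge_energy u A O + edge_energy u B O + edge_energy u C O + edge_energy u D O
  + edge_energy u A F + edge_energy u D E
  + triangle_penalty eta u (A, O, B) + triangle_penalty eta u (C, O, D).
Proof.
rewrite /energy /spring_energy !big_cons !big_nil /=.
by rewrite !(mul1r (_ ^+ 2)) !addr0 !addrA.
Qed.

Local Ltac lattice_eq :=
  rewrite /shift !mulr0n ?mulr1n ?addr0 ?add0r;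
  apply/matrixP => i j; rewrite !mxE; case: ifP => _; rewrite -?/s; field.

(** The first two congruences are those of the vertices under the reflection at
[O]; the last two move the springs [AF] and [DE] to the edges [CD] and [BA]
that the two triangles lack inside the cell. *)
Lemma kagome_congruent :
  [/\ congruent (kagome R) A A C C, congruent (kagome R) B B D D,
      congruent (kagome R) A F C D & congruent (kagome R) D E B A].
Proof.
have [[? ? ? ?] [? ? ?]] := kagome_nodes R.
split; (split; first by []).
- by exists 0%N, 0%N, 0%N, 1%N; split; lattice_eq.
- by exists 1%N, 0%N, 0%N, 1%N; split; lattice_eq.
- by exists 0%N, 0%N, 0%N, 1%N; split; lattice_eq.
- by exists 0%N, 1%N, 1%N, 0%N; split; lattice_eq.
Qed.

Lemma kagome_cell_area : cell_area (kagome R) = 2 * s.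
Proof.
rewrite /cell_area /= det_pt ger0_norm -/s; first by field.
have : 0 <= s by exact: sqrtr_ge0.
lra.
Qed.

(** The springs are exactly the edges of the two triangles, so that the energies
agree after summation over a period. *)
Lemma kagome_effective_energy eta lam : 0 < eta -> eta < 1 ->
  excess lam / (28 * cell_area (kagome R)) <=
  effective_energy (kagome R) eta lam.
Proof.
move=> eta0 eta1; have [AC BD AF DE] := kagome_congruent.
apply: (@effective_energy_ge_excess _ _ eta lam A O B C D) => //.
- by rewrite kagome_cell_area mulr_gt0 // sqrtr_gt0.
- by rewrite !ptD; congr pt; ring.
- by rewrite !ptD; congr pt; ring.
- exact: kagome_triangle_rigid.
move=> k psi per; rewrite le_eqVlt; apply/orP; left; apply/eqP.
pose u a b := cell_deformation (kagome R) lam psi a b.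
pose rest a b := edge_energy (u a b) A O + edge_energy (u a b) O B
  + edge_energy (u a b) C O + edge_energy (u a b) O D
  + triangle_penalty eta (u a b) (A, O, B)
  + triangle_penalty eta (u a b) (C, O, D).
transitivity (\sum_(a < k) \sum_(b < k) rest a b
  + \sum_(a < k) \sum_(b < k) edge_energy (u a b) B A
  + \sum_(a < k) \sum_(b < k) edge_energy (u a b) C D).
  rewrite -!big_split; apply: eq_bigr => a _; rewrite -!big_split.
  apply: eq_bigr => b _ /=.
  by rewrite (edge_energyC _ B A) /rest /triangle_penalty; ring.
rewrite -(sum_edge_energy_congruent lam per AF).
rewrite -(sum_edge_energy_congruent lam per DE).
rewrite -!big_split; apply: eq_bigr => a _; rewrite -!big_split.
apply: eq_bigr => b _ /=.
rewrite /cell_energy kagome_energyE /rest.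
by rewrite (edge_energyC _ O B) (edge_energyC _ O D); ring.
Qed.

End Kagome.

Section RotatingSquares.
Let M := rotating_squares R.
Let O : 'cV[R]_2 := pt 0 0.
Let A : 'cV[R]_2 := pt (- 1) 1.
Let B : 'cV[R]_2 := pt 0 1.
Let C : 'cV[R]_2 := pt 1 1.
Let D : 'cV[R]_2 := pt (- 1) 0.
Let E : 'cV[R]_2 := pt 1 0.
Let F : 'cV[R]_2 := pt (- 1) (- 1).
Let G : 'cV[R]_2 := pt 0 (- 1).
Let H : 'cV[R]_2 := pt 1 (- 1).

Lemma squares_energyE eta u :
  energy M eta u =
  edge_energy u A B + 2 * edge_energy u A O + edge_energy u A D
  + edge_energy u B C + edge_energy u B O + edge_energy u D O
  + edge_energy u E O + edge_energy u D F + edge_energy u O G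
  + 2 * edge_energy u O H
  + triangle_penalty eta u (A, O, B) + triangle_penalty eta u (A, O, D)
  + triangle_penalty eta u (E, O, H) + triangle_penalty eta u (G, O, H).
Proof.
rewrite /energy /spring_energy !big_cons !big_nil /=.
by rewrite !(mul1r (_ ^+ 2)) !addr0 !addrA.
Qed.

Local Ltac lattice_eq :=
  rewrite /shift !mulr0n ?mulr1n ?addr0 ?add0r;
  apply/matrixP => i j; rewrite !mxE; case: ifP => _; ring.

(** Of the four penalized triangles, [(A, O, B)] and [(G, O, H)] are reflected
into each other at [O]; the spring [BC] is moved to their missing edge [GH]. *)
Lemma squares_congruent :
  [/\ congruent M A A H H, congruent M B B G G & congruent M B C G H].
Proof.
have [[? ? ? ? ?] [? ? ? ?]] := rotating_squares_nodes R.
split; (split; first by []).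
- by exists 1%N, 0%N, 0%N, 1%N; split; lattice_eq.
- by exists 0%N, 0%N, 0%N, 1%N; split; lattice_eq.
- by exists 0%N, 0%N, 0%N, 1%N; split; lattice_eq.
Qed.

Lemma squares_cell_area : cell_area M = 4.
Proof. by rewrite /cell_area /= det_pt ger0_norm; [ring | lra]. Qed.

Lemma triangle_penalty_ge0 eta u T : 0 < eta -> 0 <= triangle_penalty eta u T.
Proof.
case: T => -[P Q] W eta0; rewrite mulr_ge0 ?divr_ge0 //.
by rewrite /penalty; case: ifP => // _; rewrite invr_ge0 ltW.
Qed.

(** The springs and triangles that do not belong to [(A, O, B)] and [(G, O, H)]
contribute a nonnegative energy and are discarded; of the diagonal springs half
is kept. *)
Lemma squares_effective_energy eta lam : 0 < eta -> eta < 1 ->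
  excess lam / (28 * cell_area M) <= effective_energy M eta lam.
Proof.
move=> eta0 eta1; have [AH BG BC] := squares_congruent.
apply: (@effective_energy_ge_excess _ _ eta lam A O B H G) => //.
- by rewrite squares_cell_area.
- by rewrite !ptD; congr pt; ring.
- by rewrite !ptD; congr pt; ring.
- exact: squares_triangle_rigid.
move=> k psi per.
pose u a b := cell_deformation M lam psi a b.
have penHG v :
    triangle_penalty eta v (H, O, G) = triangle_penalty eta v (G, O, H).
  have dH : \det (edge_mx H O G) = 1 by rewrite det_pt; ring.
  have dG : \det (edge_mx G O H) = -1 by rewrite det_pt; ring.
  rewrite /triangle_penalty affine_gradient_swap ?dH ?dG ?oppr_eq0 ?oner_eq0 //.
  by rewrite /triangle_area dH dG normrN.
pose rest a b := edge_energy (u a b) A O + edge_energy (u a b) A B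
  + edge_energy (u a b) O B + edge_energy (u a b) H O + edge_energy (u a b) O G
  + triangle_penalty eta (u a b) (A, O, B)
  + triangle_penalty eta (u a b) (G, O, H).
have -> : \sum_(a < k) \sum_(b < k)
    (triangle_energy eta (u a b) (A, O, B) +
     triangle_energy eta (u a b) (H, O, G)) =
    \sum_(a < k) \sum_(b < k) rest a b
    + \sum_(a < k) \sum_(b < k) edge_energy (u a b) G H.
  rewrite -!big_split; apply: eq_bigr => a _; rewrite -!big_split.
  apply: eq_bigr => b _ /=.
  have := penHG (u a b).
  rewrite /rest (edge_energyC _ G H) /triangle_penalty => ->.
  by ring.
rewrite -(sum_edge_energy_congruent lam per BC).
rewrite -!big_split; apply: ler_sum => a _; rewrite -!big_split.
apply: ler_sum => b _ /=.
rewrite /cell_energy squares_energyE -/(u a b) /rest.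
rewrite (edge_energyC _ O B) (edge_energyC _ H O).
have e0 P Q : 0 <= edge_energy (u a b) P Q by exact: edge_energy_ge0.
have p0 T : 0 <= triangle_penalty eta (u a b) T by exact: triangle_penalty_ge0.
have := e0 A O; have := e0 A D; have := e0 D O; have := e0 E O; have := e0 D F.
have := e0 O H; have := p0 (A, O, D); have := p0 (E, O, H).
by lra.
Qed.

End RotatingSquares.
End Cells.

(** The constant is [1 / (224 |U|)], where [224 = 8 * 28] combines the factor
[8] of [stretches_le_excess] with the factor [28 = 56 / 2] that comes from two
triangles in each cell. *)
Theorem theorem2p5 (R : realType) (M : metamaterial R)
    (hM : M = kagome R \/ M = rotating_squares R) :
  exists eta0 C : R,
    [/\ 0 < eta0, 0 < C &
      forall (eta : R) (lam : 'M[R]_2) (l1 l2 : R),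
        0 < eta -> eta < eta0 -> principal_stretches lam l1 l2 ->
        (0 <= \det lam ->
           C * ((l1 - l2) ^+ 2 + pos_part (l1 - 1) ^+ 2
                + pos_part (l2 - 1) ^+ 2)
           <= effective_energy M eta lam) /\
        (\det lam < 0 ->
           C * ((l1 + l2) ^+ 2 + pos_part (l1 - 1) ^+ 2
                + pos_part (l2 - 1) ^+ 2)
           <= effective_energy M eta lam)].
Proof.
have [area_gt0 bound] : 0 < cell_area M /\ forall eta lam, 0 < eta -> eta < 1 ->
    excess lam / (28 * cell_area M) <= effective_energy M eta lam.
  case: hM => ->; split.
  - by rewrite kagome_cell_area mulr_gt0 // sqrtr_gt0.
  - exact: kagome_effective_energy.
  - by rewrite squares_cell_area.
  - exact: squares_effective_energy.
exists 1, (224 * cell_area M)^-1; split; rewrite ?ltr01 ?invr_gt0 ?mulr_gt0 //.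
move=> eta lam l1 l2 eta0 eta1 /stretches_le_excess[pos neg].
have lower (x : R) : x <= 8 * excess lam ->
    (224 * cell_area M)^-1 * x <= effective_energy M eta lam.
  move=> hx; apply: le_trans (bound eta lam eta0 eta1).
  have -> : excess lam / (28 * cell_area M) =
      (224 * cell_area M)^-1 * (8 * excess lam) by field; rewrite gt_eqF.
  by rewrite ler_wpM2l // invr_ge0 mulr_ge0 // ltW.
by split=> det_sgn; apply: lower; [exact: pos | exact: neg].
Qed.
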